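(* The elements $\lbrace \mathcal A_k\rbrace_{k\in\mathbb Z}$, $\lbrace \mathcal B_k\rbrace_{0\neq k\in\mathbb Z}$ form a basis for the vector space $\mathcal O$. Moreover, for all $k,\ell\in\mathbb Z$, \begin{align*} [\mathcal A_k,\mathcal A_\ell] &= \mathcal B_{k-\ell}-\mathcal B_{\ell-k},\\ [\mathcal B_k,\mathcal A_\ell] &= \mathcal A_{k+\ell}-\mathcal A_{\ell-k},\\ [\mathcal B_k,\mathcal B_\ell] &= 0. \end{align*}
   Context: $\mathbb F$ is a field of characteristic zero; all vector spaces and Lie algebras are over $\mathbb F$. $\mathbb F[t,t^{-1}]$ is the algebra of Laurent polynomials. $L(\mathfrak{gl}_2)=\mathfrak{gl}_2\otimes\mathbb F[t,t^{-1}]$ is the loop algebra, with Lie bracket $[u\otimes\varphi,v\otimes\phi]=[u,v]\otimes\varphi\phi$; its elements are viewed as $2\times 2$ matrices with entries in $\mathbb F[t,t^{-1}]$, with bracket $[x,y]=xy-yx$. For $x=\begin{pmatrix} a(t)&b(t)\\ c(t)&d(t)\end{pmatrix}\in L(\mathfrak{gl}_2)$ define $\theta(x)=\begin{pmatrix} d(t^{-1})&c(t^{-1})\\ b(t^{-1})&a(t^{-1})\end{pmatrix}$ and $\varepsilon(x)=a(1)+d(1)\in\mathbb F$. Then $\theta$ is a Lie algebra automorphism of $L(\mathfrak{gl}_2)$ with $\theta^2=\mathrm{id}$, and $\varepsilon:L(\mathfrak{gl}_2)\to\mathbb F$ is a Lie algebra homomorphism ($\mathbb F$ abelian). Let $\mathcal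 L=\ker\varepsilon$, and let $\mathcal O$ be the Lie algebra of all elements of $\mathcal L$ fixed by $\theta$. For $k\in\mathbb Z$ define $$\mathcal A_k=\begin{pmatrix}0&t^k\\ t^{-k}&0\end{pmatrix},\qquad \mathcal B_k=\begin{pmatrix}t^k-1&0\\ 0&t^{-k}-1\end{pmatrix}.$$ *)

(* Defs.v *)
From HB Require Import structures.
From mathcomp Require Import all_boot all_order all_algebra finmap.
From mathcomp.multinomials Require Import monalg.

Set Implicit Arguments.
Unset Strict Implicit.
Unset Printing Implicit Defensive.

Import GRing.Theory.

Local Open Scope ring_scope.

(* Laurent polynomials F[t, t^-1]: finitely supported families of coefficients
   indexed by int.  [malg] supplies the F-module structure; its product needs
   monomials without inverses, so the ring structure is built here. *)
Definition laurent (F : fieldType) : Type := {malg F[int]}.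

HB.instance Definition _ (F : fieldType) := GRing.Lmodule.on (laurent F).

(* [Tpow k] is t^k. *)
Definition Tpow {F : fieldType} (k : int) : laurent F := mkmalgU k 1.

(* [lsubst h p] replaces t^k by [h k] in p. *)
HB.lock Definition lsubst {F : fieldType} {V : lmodType F} (h : int -> V)
    (p : laurent F) : V :=
  \sum_(k <- msupp p) mcoeff k p *: h k.

Section LSubst.
Variables (F : fieldType) (V : lmodType F).
Implicit Types (h : int -> V) (p q : laurent F).

Lemma lsubstE h p :
  lsubst h p = \sum_(k <- msupp p) mcoeff k p *: h k.
Proof. by rewrite lsubst.unlock. Qed.

Lemma lsubstEw h (d : {fset int}) p : (msupp p `<=` d)%fset ->
  lsubst h p = \sum_(k <- d) mcoeff k p *: h k.
Proof.
move=> sub; rewrite lsubstE (big_fset_incl _ sub) //=.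
by move=> k _ /mcoeff_outdom ->; rewrite scale0r.
Qed.

Lemma lsubst_is_linear h : linear (lsubst h).
Proof.
move=> a p q; set d := (msupp p `|` msupp q)%fset.
have sp : (msupp p `<=` d)%fset by exact: fsubsetUl.
have sq : (msupp q `<=` d)%fset by exact: fsubsetUr.
have spq : (msupp (a *: p + q : laurent F) `<=` d)%fset.
  apply: fsubset_trans (msuppD_le _ _) _.
  by apply: fsetUSS; [exact: msuppZ_le|].
rewrite (lsubstEw h sp) (lsubstEw h sq) (lsubstEw h spq) scaler_sumr -big_split.
apply: eq_bigr => k _ /=.
by rewrite mcoeffD mcoeffZ scalerDl scalerA.
Qed.

HB.instance Definition _ h :=
  GRing.isLinear.Build F (laurent F) V *:%R (lsubst h) (lsubst_is_linear h).

Lemma lsubstT h k : lsubst h (Tpow k) = h k.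
Proof. by rewrite lsubstE msuppU oner_eq0 big_seq_fset1 mcoeffUU scale1r. Qed.

Lemma laurentE p : p = \sum_(k <- msupp p) mcoeff k p *: Tpow k.
Proof.
rewrite {1}[p]monalgE; apply: eq_bigr => k _; apply/malgP => j.
by rewrite /Tpow mcoeffZ !mcoeffU mulr_natr.
Qed.

Lemma eq_lsubst h1 h2 p : h1 =1 h2 -> lsubst h1 p = lsubst h2 p.
Proof. by move=> e; rewrite !lsubstE; apply: eq_bigr => k _; rewrite e. Qed.

Lemma lin_ext (f g : {linear laurent F -> V}) :
  (forall k, f (Tpow k) = g (Tpow k)) -> f =1 g.
Proof.
move=> e p; rewrite [p]laurentE !linear_sum.
by apply: eq_bigr => k _; rewrite !linearZ /= e.
Qed.

End LSubst.

(* The convolution product, determined by t^i t^j = t^(i + j). *)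
HB.lock Definition lmul {F : fieldType} (p q : laurent F) : laurent F :=
  lsubst (fun i => lsubst (fun j => Tpow (i + j)) q) p.

Section LaurentRing.
Variable F : fieldType.
Implicit Types (p q r : laurent F).

Local Notation lmul := (@lmul F).

Lemma lmulE p q :
  lmul p q = lsubst (fun i => lsubst (fun j => Tpow (i + j)) q) p.
Proof. by rewrite lmul.unlock. Qed.

Lemma lsubst_comp (V : lmodType F) (h : int -> V) (g : int -> laurent F) p :
  lsubst h (lsubst g p) = lsubst (fun k => lsubst h (g k)) p.
Proof.
rewrite (lsubstE g) [RHS]lsubstE linear_sum.
by apply: eq_bigr => k _; rewrite linearZ.
Qed.

Lemma lmulC : commutative lmul.
Proof.
move=> p q; rewrite !lmulE 2!lsubstE.
under eq_bigr do rewrite lsubstE.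
under [RHS]eq_bigr do rewrite lsubstE.
under eq_bigr do rewrite scaler_sumr.
rewrite exchange_big; apply: eq_bigr => j _; rewrite scaler_sumr.
by apply: eq_bigr => i _; rewrite !scalerA mulrC addrC.
Qed.

Lemma lmulA : associative lmul.
Proof.
move=> p q r; rewrite !lmulE lsubst_comp; apply: eq_lsubst => i.
rewrite !lsubst_comp; apply: eq_lsubst => j.
rewrite lsubstT lsubst_comp; apply: eq_lsubst => l.
by rewrite lsubstT addrA.
Qed.

Lemma lmul1 : left_id (Tpow 0) lmul.
Proof.
move=> p; rewrite lmulE lsubstT [RHS]laurentE lsubstE.
by apply: eq_bigr => k _; rewrite add0r.
Qed.

Lemma lmulDl : left_distributive lmul +%R.
Proof. by move=> p q r; rewrite !lmulE linearD. Qed.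

Lemma Tpow0_neq0 : Tpow 0 != 0 :> laurent F.
Proof.
apply/eqP => /(congr1 (mcoeff 0)); rewrite /Tpow mcoeffUU mcoeff0.
by apply/eqP; rewrite oner_eq0.
Qed.

HB.instance Definition _ := GRing.Zmodule_isComNzRing.Build (laurent F)
  lmulA lmulC lmul1 lmulDl Tpow0_neq0.

Lemma lscaleAl (a : F) p q : a *: (p * q) = (a *: p) * q.
Proof. by rewrite /GRing.mul /= !lmulE linearZ. Qed.

HB.instance Definition _ :=
  GRing.Lmodule_isLalgebra.Build F (laurent F) lscaleAl.
HB.instance Definition _ := GRing.Lalgebra_isComAlgebra.Build F (laurent F).

Lemma TpowD i j : Tpow (i + j) = Tpow i * Tpow j :> laurent F.
Proof. by rewrite [RHS]/GRing.mul /= lmulE !lsubstT. Qed.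

Lemma lsubstM (A : algType F) (h : int -> A) p q :
  (forall i j, h (i + j) = h i * h j) ->
  lsubst h (p * q) = lsubst h p * lsubst h q.
Proof.
move=> hD; rewrite [X in lsubst h X]/GRing.mul /= lmulE lsubst_comp.
rewrite [LHS]lsubstE (lsubstE h p) mulr_suml; apply: eq_bigr => i _.
rewrite -scalerAl lsubst_comp 2!lsubstE mulr_sumr; congr (_ *: _).
apply: eq_bigr => j _; rewrite -scalerAr -hD; congr (_ *: _).
exact: lsubstT.
Qed.

(* p(t^-1) and p(1). *)
Definition inv_t p : laurent F := lsubst (fun k => Tpow (- k)) p.

Definition at_one p : F := lsubst (V := F^o) (fun => 1) p.

HB.instance Definition _ :=
  GRing.isLinear.Build F (laurent F) (laurent F) *:%R inv_t
    (lsubst_is_linear (fun k => Tpow (- k))).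
HB.instance Definition _ :=
  GRing.isLinear.Build F (laurent F) F *%R at_one
    (@lsubst_is_linear F F^o (fun => 1)).

Lemma inv_tT k : inv_t (Tpow k) = Tpow (- k).
Proof. exact: lsubstT. Qed.

Lemma at_oneT k : at_one (Tpow k) = 1.
Proof. exact: (@lsubstT F F^o). Qed.

Lemma inv_tD : {morph inv_t : p q / p + q}.
Proof. exact: raddfD. Qed.

Lemma at_oneD : {morph at_one : p q / p + q}.
Proof. exact: raddfD. Qed.

Lemma inv_tM p q : inv_t (p * q) = inv_t p * inv_t q.
Proof. by apply: lsubstM => i j; rewrite opprD TpowD. Qed.

Lemma at_oneM p q : at_one (p * q) = at_one p * at_one q.
Proof. by apply: (lsubstM (A := F^o)) => i j; rewrite mulr1. Qed.

Lemma inv_tK : involutive inv_t.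
Proof.
move=> p; rewrite /inv_t lsubst_comp [RHS]laurentE lsubstE.
by apply: eq_bigr => k _; rewrite lsubstT opprK.
Qed.

Lemma at_one_inv_t p : at_one (inv_t p) = at_one p.
Proof.
rewrite /at_one /inv_t lsubst_comp; apply: (@eq_lsubst F F^o) => k.
exact: (@lsubstT F F^o).
Qed.

End LaurentRing.

(* L(gl_2).  As a bare matrix type it is only a module over the Laurent
   polynomials; the alias carries the F-vector space structure. *)
Definition lgl2 (F : fieldType) : Type := 'M[laurent F]_2.

HB.instance Definition _ (F : fieldType) := GRing.NzRing.on (lgl2 F).

Section LoopAlgebra.
Variable F : fieldType.
Implicit Types (x y : lgl2 F) (k l : int).

Definition lgl2_scale (a : F) x : lgl2 F := map_mx ( *:%R a) x.

Lemma lgl2_scaleA a b x :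
  lgl2_scale a (lgl2_scale b x) = lgl2_scale (a * b) x.
Proof. by apply/matrixP => i j; rewrite !mxE scalerA. Qed.

Lemma lgl2_scale1 : left_id 1 lgl2_scale.
Proof. by move=> x; apply/matrixP => i j; rewrite !mxE scale1r. Qed.

Lemma lgl2_scaleDr : right_distributive lgl2_scale +%R.
Proof. by move=> a x y; apply/matrixP => i j; rewrite !mxE scalerDr. Qed.

Lemma lgl2_scaleDl x : {morph lgl2_scale^~ x : a b / a + b}.
Proof. by move=> a b; apply/matrixP => i j; rewrite !mxE scalerDl. Qed.

HB.instance Definition _ := GRing.Zmodule_isLmodule.Build F (lgl2 F)
  lgl2_scaleA lgl2_scale1 lgl2_scaleDr lgl2_scaleDl.

Lemma lgl2_scaleE (a : F) x i j : (a *: x) i j = a *: x i j.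
Proof. by rewrite mxE. Qed.

Lemma lgl2_scaleAl (a : F) x y : a *: (x * y) = (a *: x) * y.
Proof.
apply/matrixP => i j; rewrite !mxE scaler_sumr; apply: eq_bigr => k _.
by rewrite !mxE scalerAl.
Qed.

HB.instance Definition _ :=
  GRing.Lmodule_isLalgebra.Build F (lgl2 F) lgl2_scaleAl.

Lemma lgl2_scaleAr (a : F) x y : a *: (x * y) = x * (a *: y).
Proof.
apply/matrixP => i j; rewrite !mxE scaler_sumr; apply: eq_bigr => k _.
by rewrite !mxE scalerAr.
Qed.

HB.instance Definition _ :=
  GRing.Lalgebra_isAlgebra.Build F (lgl2 F) lgl2_scaleAr.

Definition lie x y : lgl2 F := x * y - y * x.

(* The matrix with rows (a, b) and (c, d). *)
Definition mx22 (a b c d : laurent F) : lgl2 F :=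
  \matrix_(i, j) if i == 0 then if j == 0 then a else b
                 else if j == 0 then c else d.

Lemma mx22E (a b c d : laurent F) :
  [/\ mx22 a b c d 0 0 = a, mx22 a b c d 0 1 = b,
      mx22 a b c d 1 0 = c & mx22 a b c d 1 1 = d].
Proof. by split; rewrite mxE. Qed.

Lemma lgl2P x y : x 0 0 = y 0 0 -> x 0 1 = y 0 1 ->
  x 1 0 = y 1 0 -> x 1 1 = y 1 1 -> x = y.
Proof.
move=> e00 e01 e10 e11; apply/matrixP => i j.
have ord2 (e : 'I_2) : e = if e == 0 then 0 else 1.
  by apply/val_inj; case: e => [[|[|]]].
by rewrite [i]ord2 [j]ord2; do 2!case: ifP.
Qed.

Definition theta x : lgl2 F :=
  mx22 (inv_t (x 1 1)) (inv_t (x 1 0)) (inv_t (x 0 1)) (inv_t (x 0 0)).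

Definition eps x : F := at_one (x 0 0) + at_one (x 1 1).

Lemma theta_entries x :
  [/\ theta x 0 0 = inv_t (x 1 1), theta x 0 1 = inv_t (x 1 0),
      theta x 1 0 = inv_t (x 0 1) & theta x 1 1 = inv_t (x 0 0)].
Proof. exact: mx22E. Qed.

Lemma theta_is_linear : linear theta.
Proof.
by move=> a x y; apply/matrixP => i j; rewrite !mxE; do 2!case: ifP => _;
   rewrite linearP.
Qed.

HB.instance Definition _ :=
  GRing.isLinear.Build F (lgl2 F) (lgl2 F) *:%R theta theta_is_linear.

Lemma eps_is_linear : linear_for *%R eps.
Proof. by move=> a x y; rewrite /eps !mxE !linearP /= mulrDr addrACA. Qed.

HB.instance Definition _ :=
  GRing.isLinear.Build F (lgl2 F) F *%R eps eps_is_linear.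

Lemma mul22E x y i j : (x * y) i j = x i 0 * y 0 j + x i 1 * y 1 j :> laurent F.
Proof.
rewrite mxE big_ord_recl big_ord1.
by congr (_ + x i _ * y _ j); apply/val_inj.
Qed.

Lemma thetaM x y : theta (x * y) = theta x * theta y.
Proof.
have exy i j := mul22E x y i j.
move: (x * y) exy => xy exy.
move: (theta_entries x) (theta_entries y) (theta_entries xy).
move: (theta x) (theta y) (theta xy).
move=> u v w [u00 u01 u10 u11] [v00 v01 v10 v11] [w00 w01 w10 w11].
have euv i j := mul22E u v i j.
move: (u * v) euv => uv euv.
apply: lgl2P; rewrite euv.
- by rewrite w00 exy inv_tD !inv_tM u00 u01 v00 v10 addrC.
- by rewrite w01 exy inv_tD !inv_tM u00 u01 v01 v11 addrC.
- by rewrite w10 exy inv_tD !inv_tM u10 u11 v00 v10 addrC.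
- by rewrite w11 exy inv_tD !inv_tM u10 u11 v01 v11 addrC.
Qed.

Lemma theta_lie x y : theta (lie x y) = lie (theta x) (theta y).
Proof. by rewrite /lie linearB /= !thetaM. Qed.

Lemma thetaK : involutive theta.
Proof.
move=> x; have [t00 t01 t10 t11] := theta_entries x.
have [] := theta_entries (theta x).
rewrite t00 t01 t10 t11 !inv_tK => *; exact: lgl2P.
Qed.

Lemma eps_lie x y : eps (lie x y) = 0.
Proof.
rewrite /lie linearB /= /eps.
have exy i j := mul22E x y i j; have eyx i j := mul22E y x i j.
move: (x * y) (y * x) exy eyx => xy yx exy eyx.
rewrite !exy !eyx !at_oneD !at_oneM; apply/eqP; rewrite subr_eq0; apply/eqP.
rewrite addrACA; congr (_ + _ + (_ + _)); exact: mulrC.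
Qed.

Definition calL : {pred lgl2 F} := [pred x | eps x == 0].

Definition calO : {pred lgl2 F} := [pred x | (x \in calL) && (theta x == x)].

Lemma calO_submod_closed : submod_closed calO.
Proof.
split=> [|a x y]; first by rewrite !inE !linear0 !eqxx.
rewrite !inE => /andP[/eqP ex /eqP tx] /andP[/eqP ey /eqP ty].
by rewrite !linearP /= ex ey tx ty mulr0 addr0 !eqxx.
Qed.

HB.instance Definition _ :=
  GRing.isSubmodClosed.Build F (lgl2 F) calO calO_submod_closed.

Lemma calO_lie x y : x \in calO -> y \in calO -> lie x y \in calO.
Proof.
rewrite !inE => /andP[_ /eqP tx] /andP[_ /eqP ty].
by rewrite eps_lie theta_lie tx ty !eqxx.
Qed.

Definition calA k : lgl2 F := mx22 0 (Tpow k) (Tpow (- k)) 0.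

Definition calB k : lgl2 F := mx22 (Tpow k - 1) 0 0 (Tpow (- k) - 1).

(* The family consisting of all A_k and of the B_k with k nonzero. *)
Definition AB_family (i : int + {k : int | k != 0}) : lgl2 F :=
  match i with inl k => calA k | inr k => calB (val k) end.

End LoopAlgebra.

(* The family v is a basis of the subspace U of V, which may be
   infinite-dimensional; independence makes v injective. *)
Definition is_basis (F : fieldType) (V : lmodType F) (U : submodClosed V)
    (I : choiceType) (v : I -> V) : Prop :=
  [/\ forall i, v i \in U,
      forall (s : seq I) (c : I -> F), uniq s ->
        \sum_(i <- s) c i *: v i = 0 -> {in s, forall i, c i = 0}
    & forall u, u \in U ->
        exists (s : seq I) (c : I -> F), u = \sum_(i <- s) c i *: v i].

(* Main.v *)
From HB Require Import structures.
Require Import Defs.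
From mathcomp Require Import all_boot all_order all_algebra.
From mathcomp Require Import finmap ring.
From mathcomp.multinomials Require Import monalg.

Import GRing.Theory.
Local Open Scope ring_scope.

(** An element x of O is determined by its top row (a, b): invariance under
    theta forces the bottom row to be (b(t^-1), a(t^-1)), and then
    eps x = a(1) + a(t^-1)(1) = 2 a(1), so a(1) = 0 because the characteristic
    is not 2.  Expanding b = \sum b_k t^k gives the A_k, and expanding
    a = a - a(1) = \sum a_k (t^k - 1) gives the B_k, where B_0 = 0 may be
    dropped ([calO_expansion]).

    The coefficients in this expansion can be read off x: they are the
    coefficient b_k of t^k in the upper right entry, and, for k nonzero, the
    coefficient a_k of t^k in the upper left entry.  These linear forms
    ([AB_coord]) are dual to the family, which yields independence
    ([dual_family_free]) and also provides the coefficients of the spanning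
    combination.  The bracket formulas are products of 2 x 2 matrices. *)

(** Applying f_i to a vanishing combination isolates its i-th coefficient. *)
Lemma dual_family_free (F : fieldType) (V : lmodType F) (I : eqType)
    (v : I -> V) (f : I -> V -> F) :
    (forall i, linear_for *%R (f i)) ->
    (forall i j, f i (v j) = (i == j)%:R) ->
  forall (s : seq I) (c : I -> F), uniq s ->
    \sum_(i <- s) c i *: v i = 0 -> {in s, forall i, c i = 0}.
Proof.
move=> f_lin f_dual s c s_uniq sum0 i i_s.
pose fi_lin := GRing.isLinear.Build F V F *%R (f i) (f_lin i).
pose fi : {linear V -> F | *%R} := HB.pack (f i) fi_lin.
have fZ a u : f i (a *: u) = a * f i u by exact: (linearZ_LR fi).
have /(congr1 fi) := sum0.
rewrite linear_sum linear0 (bigD1_seq i) //= big1 => [|j /negPf ji].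
  by rewrite fZ f_dual eqxx mulr1 addr0.
by rewrite fZ f_dual eq_sym ji mulr0.
Qed.

Section Entries.
Variable F : fieldType.
Implicit Types (k l : int) (p : laurent F) (x : lgl2 F).

Lemma lsubst_entry (X : int -> lgl2 F) (h : int -> laurent F) p i j :
  (forall k, X k i j = h k) -> lsubst X p i j = lsubst h p.
Proof.
move=> Xij; rewrite !lsubstE summxE; apply: eq_bigr => k _.
by rewrite lgl2_scaleE Xij.
Qed.

Lemma lsubst0 p : lsubst (fun=> 0 : laurent F) p = 0.
Proof. by rewrite lsubstE big1 // => k _; rewrite scaler0. Qed.

Lemma lsubst_Tpow p : lsubst Tpow p = p.
Proof. by rewrite lsubstE -laurentE. Qed.

(** The constants -1 add up to the sum of the coefficients of p, that is p(1):
    for h k = t^k, replacing each t^k by t^k - 1 thus recovers p exactly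
    when p(1) = 0. *)
Lemma lsubst_sub1 (h : int -> laurent F) p :
  lsubst (fun k => h k - 1) p = lsubst h p - at_one p *: 1.
Proof.
rewrite /at_one !lsubstE scaler_suml -sumrB; apply: eq_bigr => k _.
by rewrite scalerBr /GRing.scale /= mulr1.
Qed.

Lemma mx22M (a b c d a' b' c' d' : laurent F) :
  mx22 a b c d * mx22 a' b' c' d' =
  mx22 (a * a' + b * c') (a * b' + b * d')
       (c * a' + d * c') (c * b' + d * d').
Proof.
have [x00 x01 x10 x11] := mx22E a b c d.
have [y00 y01 y10 y11] := mx22E a' b' c' d'.
by apply: lgl2P; rewrite mul22E ?(x00, x01, x10, x11) ?(y00, y01, y10, y11) mxE.
Qed.

Lemma mx22B (a b c d a' b' c' d' : laurent F) :
  mx22 a b c d - mx22 a' b' c' d' = mx22 (a - a') (b - b') (c - c') (d - d').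
Proof. by apply: lgl2P; rewrite !mxE. Qed.

Lemma calA_calO k : calA F k \in @calO F.
Proof.
rewrite !inE /eps /theta /calA !mxE /= !linear0 addr0 eqxx /=.
by rewrite !inv_tT opprK.
Qed.

Lemma calB_calO k : calB F k \in @calO F.
Proof.
rewrite !inE /eps /theta /calB !mxE /= !linear0 !linearB /=.
by rewrite !at_oneT !inv_tT oppr0 opprK subrr addr0 !eqxx.
Qed.

Lemma calB0 : calB F 0 = 0.
Proof. by rewrite /calB oppr0 subrr; apply: lgl2P; rewrite !mxE. Qed.

(** As p and p(t^-1) agree at 1, the conditions eps x = 0 and theta x = x give
    2 a(1) = 0 for the upper left entry a; the characteristic is used to divide
    by 2. *)
Lemma calO_entries x : [pchar F] =i pred0 -> x \in @calO F ->
  [/\ at_one (x 0 0) = 0, x 1 0 = inv_t (x 0 1) & x 1 1 = inv_t (x 0 0)].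
Proof.
move=> F_char0; rewrite !inE => /andP[/eqP ex /eqP tx].
have [_ _ x10 x11] := theta_entries x; rewrite tx in x10 x11.
split=> //; apply/eqP; move/eqP: ex.
rewrite /eps x11 at_one_inv_t -mulr2n -mulr_natr mulf_eq0.
by have /pcharf0P -> := F_char0; rewrite orbF.
Qed.

Lemma calO_expansion x : [pchar F] =i pred0 -> x \in @calO F ->
  x = lsubst (calA F) (x 0 1) + lsubst (calB F) (x 0 0).
Proof.
move=> F_char0 /(calO_entries _ F_char0)[a1 x10 x11].
pose A_entry := lsubst_entry (calA F); pose B_entry := lsubst_entry (calB F).
apply: lgl2P; rewrite mxE.
- rewrite (A_entry (fun=> 0)) => [|k]; last by rewrite mxE.
  rewrite (B_entry (fun k => Tpow k - 1)) => [|k]; last by rewrite mxE.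
  by rewrite lsubst0 lsubst_sub1 a1 scale0r lsubst_Tpow add0r subr0.
- rewrite (A_entry Tpow) => [|k]; last by rewrite mxE.
  rewrite (B_entry (fun=> 0)) => [|k]; last by rewrite mxE.
  by rewrite lsubst0 lsubst_Tpow addr0.
- rewrite (A_entry (fun k => Tpow (- k))) => [|k]; last by rewrite mxE.
  rewrite (B_entry (fun=> 0)) => [|k]; last by rewrite mxE.
  by rewrite lsubst0 addr0 x10.
- rewrite (A_entry (fun=> 0)) => [|k]; last by rewrite mxE.
  rewrite (B_entry (fun k => Tpow (- k) - 1)) => [|k]; last by rewrite mxE.
  by rewrite lsubst0 lsubst_sub1 a1 scale0r add0r subr0 x11.
Qed.

(** On O the lower row repeats the upper one, and the constant term of the
    upper left entry follows from its vanishing at t = 1, so these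
    coefficients determine the element. *)
Definition AB_coord (i : int + {k : int | k != 0}) (x : lgl2 F) : F :=
  match i with
  | inl k => mcoeff k (x 0 1)
  | inr k => mcoeff (val k) (x 0 0)
  end.

Lemma AB_coord_linear i : linear_for *%R (AB_coord i).
Proof.
by case: i => k a x y /=; rewrite mxE lgl2_scaleE mcoeffD mcoeffZ.
Qed.

(** The upper left entry t^l - 1 of B_l contributes only its term t^l: the
    term -1 affects the coefficient of t^0, and that entry is read at nonzero
    exponents. *)
Lemma AB_coord_dual i j : AB_coord i (AB_family F j) = (i == j)%:R.
Proof.
case: i j => [k|k] [l|l]; rewrite /= mxE /= ?mcoeff0 //.
  by rewrite /Tpow mcoeffU eq_sym.
have -> : (1 : laurent F) = Tpow 0 by [].
rewrite mcoeffB /Tpow !mcoeffU (eq_sym 0) (negPf (valP k)) subr0.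
by rewrite eq_sym.
Qed.

Lemma calO_span x : [pchar F] =i pred0 -> x \in @calO F ->
  exists (s : seq (int + {k : int | k != 0})) (c : _ -> F),
    x = \sum_(i <- s) c i *: AB_family F i.
Proof.
move=> F_char0 xO.
(* [pmap insub] discards the exponent 0, which indexes no B_k. *)
exists ([seq inl k | k <- msupp (x 0 1)] ++
        [seq inr k | k : {k : int | k != 0} <- pmap insub (msupp (x 0 0))]),
  (AB_coord^~ x).
rewrite [LHS]calO_expansion // big_cat !big_map /= !lsubstE; congr (_ + _).
rewrite -(big_map val xpredT (fun k => mcoeff k (x 0 0) *: calB F k)) /=.
rewrite (pmap_filter (insubK _)) big_filter.
rewrite (bigID (fun k => k == 0)) /= big1 ?add0r => [|k /eqP->]; last first.
  by rewrite calB0 scaler0.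
by apply: eq_bigl => k; rewrite isSome_insub.
Qed.

Lemma lie_calA k l :
  lie (calA F k) (calA F l) = calB F (k - l) - calB F (l - k).
Proof.
rewrite /lie /calA /calB !mx22M !mx22B; congr mx22; rewrite ?opprB ?TpowD; ring.
Qed.

Lemma lie_calB_calA k l :
  lie (calB F k) (calA F l) = calA F (k + l) - calA F (l - k).
Proof.
rewrite /lie /calA /calB !mx22M !mx22B.
congr mx22; rewrite ?opprB ?opprD ?TpowD; ring.
Qed.

Lemma lie_calB k l : lie (calB F k) (calB F l) = 0.
Proof.
rewrite /lie /calB !mx22M !mx22B.
by apply: lgl2P; rewrite !mxE /=; ring.
Qed.

End Entries.

Theorem lemma4p4 (F : fieldType) (F_char0 : [pchar F] =i pred0) :
  is_basis (@calO F) (@AB_family F) /\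
  (forall k l : int,
     [/\ lie (calA F k) (calA F l) = calB F (k - l) - calB F (l - k),
         lie (calB F k) (calA F l) = calA F (k + l) - calA F (l - k)
       & lie (calB F k) (calB F l) = 0]).
Proof.
split; last by move=> k l; rewrite lie_calA lie_calB_calA lie_calB.
split.
- by case=> k; [exact: calA_calO | exact: calB_calO].
- exact: (dual_family_free _ _ _ _ _ (@AB_coord_linear F) (@AB_coord_dual F)).
- by move=> x; exact: calO_span.
Qed.
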